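(* Let $A,B\in\mathcal{L}(\mathcal{H})$ have closed ranges. Then $A\overset{*}{\leq}B$ if and only if $A\overset{-}{\leq}B$ and $(B-A)^\dagger=B^\dagger-A^\dagger$.
   Context: $\mathcal{H}$ is a complex Hilbert space, $\mathcal{L}(\mathcal{H})$ is the algebra of bounded linear operators on $\mathcal{H}$, and $\mathcal{R}(T)$, $\mathcal{N}(T)$ denote range and nullspace. The Moore-Penrose inverse of $T\in\mathcal{L}(\mathcal{H})$ is the (in general densely defined, unbounded) operator $T^\dagger:\mathcal{R}(T)\oplus\mathcal{R}(T)^\perp\to\mathcal{H}$ with $T^\dagger|_{\mathcal{R}(T)}=(T|_{\mathcal{N}(T)^\perp})^{-1}$ (where $T|_{\mathcal{N}(T)^\perp}:\mathcal{N}(T)^\perp\to\mathcal{R}(T)$) and $\mathcal{N}(T^\dagger)=\mathcal{R}(T)^\perp$; $T^\dagger\in\mathcal{L}(\mathcal{H})$ if and only if $\mathcal{R}(T)$ is closed. Star order: $A\overset{*}{\leq}B$ if $A^*A=A^*B$ and $AA^*=BA^*$. Minus order: $A\overset{-}{\leq}B$ if there exist idempotents $P,Q\in\mathcal{L}(\mathcal{H})$ such that $A=PB$ and $A^*=QB^*$. *)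

(* Defs.v *)
From HB Require Import structures.
From mathcomp Require Import all_boot all_order all_algebra complex.
From mathcomp Require Import all_classical all_reals topology normedtype.

Set Implicit Arguments.
Unset Strict Implicit.
Unset Printing Implicit Defensive.

Import Order.TTheory GRing.Theory Num.Theory.
Import numFieldNormedType.Exports.

Local Open Scope classical_set_scope.
Local Open Scope ring_scope.
Local Open Scope complex_scope.

(* [inner] is linear in its first argument and conjugate-linear in the
   second. *)
HB.mixin Record NormedModule_isHilbert (R : realType) H
    of NormedModule R[i] H := {
  inner : {dot H for @Num.conj R[i]} ;
  inner_norm : forall x : H, inner x x = `|x| ^+ 2
}.

#[short(type="hilbertType")]
HB.structure Definition Hilbert (R : realType) :=
  {H of CompleteNormedModule R[i] H & NormedModule_isHilbert R H}.

Record bounded_op (R : realType) (H : hilbertType R) := BoundedOp {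
  bounded_op_linear :> {linear H -> H} ;
  bounded_opP : exists M : R, forall x, `|bounded_op_linear x| <= M%:C * `|x|
}.

Section HilbertOperators.
Context {R : realType} {H : hilbertType R}.

Definition orthocompl (E : set H) : set H :=
  [set x | forall y, E y -> inner x y = 0].

Definition nullspace (T : H -> H) : set H := [set x | T x = 0].

(* For a bounded linear [T] the vector chosen here exists by the Riesz
   representation theorem, and it is always unique. *)
Definition adjoint (T : H -> H) (y : H) : H :=
  get [set z | forall x, inner (T x) y = inner x z].

Definition star_le (A B : bounded_op H) : Prop :=
  adjoint A \o A = adjoint A \o B /\ A \o adjoint A = B \o adjoint A.

Definition idempotent_op (P : bounded_op H) : Prop := P \o P = P.

Definition minus_le (A B : bounded_op H) : Prop :=
  exists P Q : bounded_op H,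
    [/\ idempotent_op P, idempotent_op Q,
        A = P \o B :> (H -> H) & adjoint A = Q \o adjoint B].

(* An operator with its domain; the values of [partial_fun] outside of
   [partial_dom] carry no meaning, hence [partial_eq] below. *)
Record partial_op := PartialOp {
  partial_dom : set H ;
  partial_fun :> H -> H
}.

Definition partial_eq (S T : partial_op) : Prop :=
  partial_dom S = partial_dom T /\
  forall w, partial_dom S w -> S w = T w.

Definition partial_sub (S T : partial_op) : partial_op :=
  PartialOp (partial_dom S `&` partial_dom T) (fun w => S w - T w).

(* The sum of the inverse of [T] restricted to [N(T)^\perp], on [R(T)], and of
   the zero operator, on [R(T)^\perp]: at [w = y + z] with [y] in [R(T)] and
   [z] in [R(T)^\perp], its value is the unique [x] in [N(T)^\perp] such that
   [T x = y]. *)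
Definition mp_inverse (T : {linear H -> H}) : partial_op :=
  PartialOp
    [set y + z | y in range T & z in orthocompl (range T)]
    (fun w => get [set x | orthocompl (nullspace T) x /\
       exists2 z, orthocompl (range T) z & w = T x + z]).

Lemma inner_eq0 (x : H) : inner x x = 0 -> x = 0.
Proof. by rewrite inner_norm => /eqP; rewrite sqrf_eq0 normr_eq0 => /eqP. Qed.

Lemma adjointE (T : H -> H) (y z : H) :
  (forall x, inner (T x) y = inner x z) -> adjoint T y = z.
Proof.
move=> Tyz; apply/subr0_eq/inner_eq0; rewrite linearB /=.
have Tya : forall x, inner (T x) y = inner x (adjoint T y).
  exact: (@getI _ [set z' | forall x, inner (T x) y = inner x z'] z).
by rewrite -Tyz -Tya subrr.
Qed.

Lemma mp_inverseE (T : {linear H -> H}) (x z : H) :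
  orthocompl (nullspace T) x -> orthocompl (range T) z ->
  mp_inverse T (T x + z) = x.
Proof.
move=> Nx Rz; rewrite /mp_inverse /=.
set E := [set _ | _]; have Ex : E x by split => //; exists z.
have [Ny [z' Rz' Tyz']] : E (get E) by exact: getI Ex.
move: (get E) Ny Tyz' => y Ny Tyz'; apply/esym/subr0_eq/inner_eq0.
have Txy : T (x - y) = z' - z.
  rewrite linearB; apply/eqP.
  by rewrite subr_eq addrAC eq_sym subr_eq eq_sym Tyz' addrC.
have Txy0 : T (x - y) = 0.
  apply: inner_eq0; rewrite {1}Txy linearBl /=.
  by rewrite Rz' ?Rz ?subrr//; exists (x - y).
by rewrite linearBl /= Nx ?Ny ?subrr.
Qed.

End HilbertOperators.

(* Main.v *)
From HB Require Import structures.
Require Import Defs.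
From mathcomp Require Import all_boot all_order all_algebra complex.
From mathcomp Require Import all_classical all_reals topology normedtype.
From mathcomp Require Import ring.
Import Order.TTheory GRing.Theory Num.Theory.
Import numFieldNormedType.Exports.

(** Write [C := B - A].  Everything rests on the description [star_leP] of the
star order: [A] is below [B] exactly when the ranges of [A] and [C] are
orthogonal and [B] agrees with [A] on [N(A)^\perp].

If this holds, then [A = P B] and [A^* = Q B^*] for the orthogonal projections
[P] onto [R(A)] and [Q] onto [N(A)^\perp], which gives the minus order.
Moreover write [w = B x + z] with [x] in [N(B)^\perp] and [z] in
[R(B)^\perp]; then [B^\dagger w = x = Q x + (x - Q x)], where [A] takes [Q x]
to [A x], and [C] takes [x - Q x] to [C x].  Hence [w = A (Q x) + (C x + z)]
and [w = C (x - Q x) + (A x + z)] are the decompositions that compute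
[A^\dagger w = Q x] and [C^\dagger w = x - Q x], and the domain of
[C^\dagger] is the whole space.

For the converse, let [A = P B] with [P] idempotent, so that [P A = A] and
[P C = 0]; the other half of the minus order puts [R(A)] inside [R(B)].  Since
[C^\dagger] is everywhere defined, [A u = c + d] with [c] in [R(C)] and [d] in
[R(C)^\perp].  Then [C^\dagger d = 0], so [B^\dagger d] and [A^\dagger d] are
one vector [x] of [N(A)^\perp], and [d = B x] because [d] lies in [R(B)].  Now
[A x = P B x = P d = P (A u - c) = A u], so [c = A x - d] is orthogonal to
[R(A)].  As [c] is also orthogonal to [d], it is orthogonal to [A u - d = c]
and vanishes.  So [A u = d] is orthogonal to [R(C)], and [A u = A x = B x]; for
[u] in [N(A)^\perp] the first equality forces [u = x], and [A u = B u].

The Hilbert space theory behind this is the existence of orthogonal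
projections onto closed subspaces, [closed_subspace_proj], and of adjoints,
[inner_adjoint], by Riesz representation. *)

Set Implicit Arguments.
Unset Strict Implicit.
Unset Printing Implicit Defensive.

Local Open Scope classical_set_scope.
Local Open Scope ring_scope.

(** * Geometry of the inner product *)

Section Geometry.
Context {R : realType} {H : hilbertType R}.
Implicit Types (x y z h : H) (E : set H).

Lemma innerC x y : inner x y = (inner y x)^*.
Proof. by rewrite (hermC _ x y) expr0 mul1r. Qed.

Lemma inner0C x y : inner x y = 0 -> inner y x = 0.
Proof. by move=> xy; rewrite innerC xy conjC0. Qed.

Lemma innerZl a x y : inner (a *: x) y = a * inner x y.
Proof. by rewrite linearZl_LR. Qed.

Lemma innerZr a x y : inner x (a *: y) = a^* * inner x y.
Proof. by rewrite linearZr_LR. Qed.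

Lemma normr2D_ortho x y : inner x y = 0 -> `|x + y| ^+ 2 = `|x| ^+ 2 + `|y| ^+ 2.
Proof. by move=> xy; rewrite -!inner_norm hnormDd. Qed.

Lemma parallelogram x y :
  `|x + y| ^+ 2 + `|x - y| ^+ 2 = 2 * (`|x| ^+ 2 + `|y| ^+ 2).
Proof. rewrite -!inner_norm dnormD dnormB; ring. Qed.

(** Pythagoras for the splitting of [x] along [h]: it yields both the
Cauchy-Schwarz inequality and the first-order condition at a nearest point. *)
Lemma normr2_project x h : h != 0 ->
  `|x| ^+ 2 = `|x - (inner x h / inner h h) *: h| ^+ 2
              + `|inner x h| ^+ 2 / `|h| ^+ 2.
Proof.
move=> h0; have hh0 : inner h h != 0 by rewrite dnorm_eq0.
set t := _ / _.
have xht : inner (x - t *: h) (t *: h) = 0.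
  by rewrite innerZr linearBl /= innerZl divfK// subrr mulr0.
rewrite -[in LHS](subrK (t *: h) x) (normr2D_ortho xht).
congr (_ + _); rewrite normrZ exprMn -inner_norm normrM normfV exprMn exprVn.
rewrite (ger0_norm (dnorm_ge0 _ _)).
by field.
Qed.

Lemma cauchy_schwarz x y : `|inner x y| <= `|x| * `|y|.
Proof.
have [->|y0] := eqVneq y 0; first by rewrite linear0r !normr0 mulr0.
rewrite -ler_sqr ?nnegrE ?mulr_ge0// exprMn -ler_pdivrMr ?exprn_gt0 ?normr_gt0//.
by rewrite (normr2_project x y0) lerDr exprn_ge0.
Qed.

Lemma continuous_innerl y : continuous (fun x => inner x y : R[i]^o).
Proof.
apply: (@bounded_linear_continuous _ H (R[i]^o) (applyr inner y)).
apply/linear_boundedP; near=> r => x /=.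
rewrite (le_trans (cauchy_schwarz _ _))// mulrC ler_wpM2r//.
near: r; apply: nbhs_pinfty_ge; rewrite ger0_real//.
Unshelve. all: by end_near. Qed.

End Geometry.

(** * Projection onto a closed subspace *)

(** The order of [R[i]] is partial, but norms are nonnegative, hence real; this
transfers infima from [R], so that distances can be handled in [R[i]]. *)
Lemma complex_inf (R : realType) (D : set R[i]) :
  D !=set0 -> (forall x, D x -> 0 <= x) ->
  exists d : R[i], (forall x, D x -> d <= x) /\
    forall e : R[i], 0 < e -> exists2 x, D x & x < d + e.
Proof.
move=> [x0 Dx0] D_ge0.
have ReD x : D x -> x = (complex.Re x)%:C%C.
  by move/D_ge0/ger0_real/RRe_real.
pose D' := [set complex.Re x | x in D].
have infD : has_inf D'.
  split; first by exists (complex.Re x0); exists x0.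
  by exists 0 => _ [x Dx <-]; rewrite -lecR -ReD// D_ge0.
exists (inf D')%:C%C; split=> [x Dx|e e0].
  by rewrite (ReD _ Dx) lecR; apply: ge_inf; [case: infD|exists x].
have eRe : e = (complex.Re e)%:C%C by apply/esym/RRe_real/gtr0_real.
have Re_gt0 : 0 < complex.Re e by rewrite -ltcR -eRe.
have [_ [x Dx <-] xlt] := inf_adherent Re_gt0 infD.
by exists x => //; rewrite (ReD _ Dx) eRe -rmorphD ltcR.
Qed.

Section Projection.
Context {R : realType} {H : hilbertType R}.
Implicit Types (x y z h w s : H) (E : set H).

Definition linear_subspace E :=
  E 0 /\ forall (a : R[i]) x y, E x -> E y -> E (a *: x + y).

(** The vectors of [E] whose squared distance to [w] is within [e] of the
infimum [d] form a filter base as [e] shrinks.  By the parallelogram identity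
it is Cauchy, so it converges to some [y] of [E].  Moving such a vector along
[h] in [E] cannot bring the squared distance below [d], which makes its
residual nearly orthogonal to [h]; the residual [w - y] of the limit is then
exactly orthogonal to [h]. *)
Lemma closed_subspace_proj E w : closed E -> linear_subspace E ->
  exists2 y, E y & orthocompl E (w - y).
Proof.
move=> clE [E0 Elin].
have [||d [d_le d_inf]] := @complex_inf R [set `|w - s| ^+ 2 | s in E].
- by exists (`|w - 0| ^+ 2), 0.
- by move=> _ [s _ <-]; rewrite exprn_ge0.
pose S (e : R[i]) := E `&` [set s | `|w - s| ^+ 2 < d + e].
pose F := filter_from [set e : R[i] | 0 < e] S.
have FF : ProperFilter F.
  apply: filter_from_proper => [|e /= e0]; last first.
    by have [_ [s Es <-] ds] := d_inf _ e0; exists s.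
  apply: filter_from_filter; first by exists 1 => /=.
  move=> e1 e2 /= e1_gt0 e2_gt0.
  wlog e12 : e1 e2 e1_gt0 e2_gt0 / e1 <= e2.
    have /orP[e12|e21] := real_leVge (gtr0_real e1_gt0) (gtr0_real e2_gt0).
      exact.
    by rewrite setIC; exact.
  exists e1 => // s [Es /= ds].
  by do !split=> //=; rewrite (lt_le_trans ds)// lerD2l.
have cF : cauchy F.
  apply/cauchy_ballP => e e0.
  exists (S (e ^+ 2 / 4), S (e ^+ 2 / 4)) => /=.
    by split; exists (e ^+ 2 / 4) => //=; rewrite divr_gt0 ?exprn_gt0.
  move=> [s s'] /= [[Es ds] [Es' ds']]; rewrite -ball_normE /=.
  (* The midpoint is in [E], hence no closer to [w] than [d]. *)
  have Em : E (2^-1 *: s + 2^-1 *: s').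
    by apply: (Elin) => //; rewrite -[_ *: s']addr0; apply: (Elin).
  have dm := d_le _ (ex_intro2 _ _ _ Em erefl).
  have mid : (w - s) + (w - s') = 2 *: (w - (2^-1 *: s + 2^-1 *: s')).
    rewrite scalerBr scalerDr !scalerA divff ?pnatr_eq0// !scale1r.
    by rewrite scaler_nat mulr2n opprD addrACA.
  have dif : (w - s) - (w - s') = s' - s by rewrite opprB addrC addrA subrK.
  have := parallelogram (w - s) (w - s').
  rewrite mid dif normrZ exprMn normr_nat => par.
  rewrite -ltr_sqr ?nnegrE ?(ltW e0)// distrC.
  rewrite -(ltrD2l (2 ^+ 2 * d)).
  apply: (@le_lt_trans _ _ (2 * (`|w - s| ^+ 2 + `|w - s'| ^+ 2))).
    rewrite -par lerD2r. by rewrite ler_wpM2l ?exprn_ge0.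
  have -> : 2 ^+ 2 * d + e ^+ 2 = 2 * ((d + e ^+ 2 / 4) + (d + e ^+ 2 / 4)).
    by field.
  by rewrite ltr_pM2l// ltrD.
have [y Fy] : exists y : H, F --> y by apply/(@cvg_ex H); exact: cauchy_cvg.
exists y.
  apply: (closed_cvg (F := F) (u_ := id) _ clE _ _ Fy).
  by exists 1 => //= s [].
move=> h Eh; have [->|h0] := eqVneq h 0; first exact: linear0r.
have lim_y : (fun s => inner (w - s) h : R[i]^o) @ F -->
    (inner (w - y) h : R[i]^o).
  apply: (@continuous_cvg H H R[i]^o F _ (fun s => w - s)
    (fun x => inner x h) (w - y)).
    exact: continuous_innerl.
  by apply: cvgB => //; exact: cvg_cst.
(* For any [r > 0], the squared inner product is at most [r * `|h| ^+ 2] on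
   [S r]. *)
have lim_0 : (fun s => inner (w - s) h : R[i]^o) @ F --> (0 : R[i]^o).
  apply/cvgr0Pnorm_lt => e e0.
  exists ((e / `|h|) ^+ 2); first by rewrite /= exprn_gt0 // divr_gt0 ?normr_gt0.
  move=> s [Es /= ds].
  have := normr2_project (w - s) h0; set t := _ / _ => ws.
  have dst := d_le _ (ex_intro2 _ _ _ (Elin t _ _ Eh Es) erefl).
  rewrite -addrA -opprD [_ + t *: h]addrC in ws.
  move: ds; rewrite ws => /(le_lt_trans (lerD dst (lexx _))).
  rewrite ltrD2l exprMn exprVn ltr_pM2r ?invr_gt0 ?exprn_gt0 ?normr_gt0//.
  by rewrite ltr_sqr// ?nnegrE// ltW.
exact: (cvg_unique _ lim_y lim_0).
Qed.

End Projection.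

(** * Bounded operators, orthogonal projections and adjoints *)

Section Operators.
Context {R : realType} {H : hilbertType R}.
Implicit Types (x y z h w u : H) (E : set H) (T : bounded_op H).

Lemma continuous_bounded_op T : continuous T.
Proof.
have [M TM] := bounded_opP T.
apply/bounded_linear_continuous/linear_boundedP; near=> r => x.
rewrite (le_trans (TM x))// ler_wpM2r//.
near: r; apply: nbhs_pinfty_ge.
by rewrite realE (lecR 0) (lecR M 0); exact: num_real.
Unshelve. all: by end_near. Qed.

Lemma closed_kernel (V : normedModType R[i]) (f : {linear H -> V}) :
  continuous f -> closed [set x | f x = 0].
Proof.
move=> cf; apply: (preimage_closed (D := [set 0])) => [x _|]; first exact: cf.
exact/accessible_closed_set1/hausdorff_accessible/norm_hausdorff.
Qed.

Lemma subspace_kernel (V : lmodType R[i]) (f : {linear H -> V}) :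
  linear_subspace [set x | f x = 0].
Proof.
by split=> [|a x y /= fx fy]; rewrite /= ?linear0// linearP fx fy scaler0 addr0.
Qed.

Lemma subspace_range T : linear_subspace (range T).
Proof.
split=> [|a _ _ [x _ <-] [y _ <-]]; first by exists 0 => //; rewrite linear0.
by exists (a *: x + y) => //; rewrite linearP.
Qed.

Lemma subspace_orthocompl E : linear_subspace (orthocompl E).
Proof.
split=> [y _|a x y Ex Ey h Eh]; first exact: linear0l.
by rewrite linearDl /= innerZl Ex// Ey// mulr0 addr0.
Qed.

Lemma closed_orthocompl E : closed (orthocompl E).
Proof.
have -> : orthocompl E = \bigcap_(h in E) [set x | inner x h = 0].
  by apply/seteqP; split.
apply: closed_bigI => h _.
have := @closed_kernel R[i]^o (applyr inner h) (@continuous_innerl R H h).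
exact.
Qed.

Lemma orthocompl_proj_unique E x y y' : linear_subspace E -> E y -> E y' ->
  orthocompl E (x - y) -> orthocompl E (x - y') -> y = y'.
Proof.
move=> [_ Elin] Ey Ey' xy xy'; apply/subr0_eq/inner_eq0.
have Ed : E (y - y') by rewrite -scaleN1r addrC; exact: Elin.
have {1}-> : y - y' = (x - y') - (x - y) by rewrite opprB [RHS]addrC addrA subrK.
by rewrite linearBl /= xy// xy'// subrr.
Qed.

(** The projection of [w] onto [E] leaves a residual that lies both in
[E^\perp] and in [E^\perp\perp]. *)
Lemma orthocomplK E : closed E -> linear_subspace E ->
  orthocompl (orthocompl E) `<=` E.
Proof.
move=> clE sE w wE; have [y Ey wy] := closed_subspace_proj w clE sE.
suff <- : y = w by [].
apply/esym/(@orthocompl_proj_unique (orthocompl (orthocompl E)) w) => //.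
- exact: subspace_orthocompl.
- by move=> h hE; rewrite inner0C// hE.
- by rewrite subrr; case: (subspace_orthocompl (orthocompl (orthocompl E))).
- by move=> h hE; rewrite inner0C// hE.
Qed.

Definition orthogonal_projection E (P : bounded_op H) : Prop :=
  forall x, E (P x) /\ orthocompl E (x - P x).

Lemma closed_subspace_projection E : closed E -> linear_subspace E ->
  exists P : bounded_op H, orthogonal_projection E P.
Proof.
move=> clE sE.
have /choice[f fP] x : exists y, E y /\ orthocompl E (x - y).
  by have [y Ey xy] := closed_subspace_proj x clE sE; exists y.
have f_lin : linear f.
  move=> a x y; apply: (orthocompl_proj_unique (x := a *: x + y) sE).
  - exact: (fP _).1.
  - by apply: sE.2; exact: (fP _).1.
  - exact: (fP _).2.
  - rewrite opprD addrACA -scalerBr.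
    by apply: (subspace_orthocompl E).2; exact: (fP _).2.
pose fL := GRing.isLinear.Build _ _ _ _ f f_lin.
pose F : {linear H -> H} := HB.pack f fL.
have F_bounded : exists M : R, forall x, `|F x| <= M%:C%C * `|x|.
  exists 1 => x; rewrite mul1r.
  have [Efx xfx] := fP x.
  rewrite -ler_sqr ?nnegrE// -{2}(subrK (f x) x) addrC.
  by rewrite normr2D_ortho ?lerDl ?exprn_ge0// inner0C// xfx.
by exists (BoundedOp F_bounded).
Qed.

Lemma projection_id E (P : bounded_op H) x y : linear_subspace E ->
  orthogonal_projection E P ->
  E y -> orthocompl E (x - y) -> P x = y.
Proof.
move=> sE PE Ey xy.
by apply: (orthocompl_proj_unique sE _ Ey _ xy); case: (PE x).
Qed.

Lemma projection_idem E (P : bounded_op H) : linear_subspace E ->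
  orthogonal_projection E P -> Defs.idempotent_op P.
Proof.
move=> sE PE; apply/funext => x /=.
apply: (projection_id sE PE); first by case: (PE x).
by rewrite subrr; case: (subspace_orthocompl E).
Qed.

Lemma projection_selfadjoint E (P : bounded_op H) x y :
  orthogonal_projection E P ->
  inner (P x) y = inner x (P y).
Proof.
move=> PE; have [[Px xPx] [Py yPy]] := (PE x, PE y).
rewrite -{1}(subrK (P y) y) linearDr /= (inner0C (yPy _ Px)) add0r.
by rewrite -{2}(subrK (P x) x) linearDl /= (xPx _ Py) add0r.
Qed.

(** The representing vector is a multiple of a vector [m] orthogonal to the
kernel: [x - (f x / f m) m] is in the kernel, so [<x, m>] is proportional to
[f x]. *)
Lemma riesz (f : {linear H -> R[i]^o}) : continuous f ->
  exists z, forall x, f x = inner x z.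
Proof.
move=> cf; have [f0|] := pselect (forall x, f x = 0).
  by exists 0 => x; rewrite linear0r f0.
move=> /existsNP[e /eqP fe].
have [n fn en] := closed_subspace_proj e (closed_kernel cf) (subspace_kernel f).
set m := e - n in en.
have fm : f m != 0 by rewrite linearB /= [f n]fn subr0.
have m0 : inner m m != 0.
  by rewrite dnorm_eq0; apply: contraNneq fm => ->; rewrite linear0.
exists ((f m / inner m m)^* *: m) => x.
rewrite innerZr conjCK.
suff -> : inner x m = f x / f m * inner m m by field; rewrite fm m0.
rewrite -innerZl; apply/subr0_eq; rewrite -linearBl /=; apply/inner0C/en => /=.
by rewrite linearB linearZ /= /GRing.scale /= divfK// subrr.
Qed.

(** This is where boundedness of [T] enters: it makes [x |-> <T x, y>] a
continuous functional, so that the vector selected by [adjoint] exists. *)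
Lemma inner_adjoint T x y : inner (T x) y = inner x (adjoint T y).
Proof.
have [z Tz] : exists z, forall x, inner (T x) y = inner x z.
  apply: (riesz (f := applyr inner y \o T)) => {}x.
  apply: (@continuous_comp H H R[i]^o T); first exact: continuous_bounded_op.
  exact: continuous_innerl.
by rewrite (adjointE Tz).
Qed.

(** The form in which [mp_inverse T] can be evaluated at [w]: its value there
is [x]. *)
Lemma mp_decomposition T w : closed (range T) ->
  exists x z, [/\ orthocompl (nullspace T) x, orthocompl (range T) z
                & w = T x + z].
Proof.
move=> clT.
have [_ [x0 _ <-] z0] := closed_subspace_proj w clT (subspace_range T).
have clN : closed (nullspace T) by apply/closed_kernel/continuous_bounded_op.
have [n Tn xn] := closed_subspace_proj x0 clN (subspace_kernel T).
exists (x0 - n), (w - T x0); split=> //.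
by rewrite linearB /= [T n]Tn subr0 addrC subrK.
Qed.

End Operators.

(** * The star order, the minus order and Moore-Penrose inverses *)

Section Orders.
Context {R : realType} {H : hilbertType R}.
Implicit Types (x y z w u v : H) (A B T : bounded_op H).

Lemma innerP x y : (forall z, inner z x = inner z y) -> x = y.
Proof. by move=> xy; apply/subr0_eq/inner_eq0; rewrite linearB /= xy subrr. Qed.

Lemma adjoint_orthocompl_nullspace T y : orthocompl (nullspace T) (adjoint T y).
Proof. by move=> n Tn; rewrite inner0C// -inner_adjoint Tn linear0l. Qed.

(** With [C = B - A], the first half of the star order, [A^* C = 0], says that
[R(C)] is orthogonal to [R(A)].  The second half, [C A^* = 0], says that [C]
vanishes on the range of [A^*], which is dense in [N(A)^\perp].  Instead of a
density argument, the proof takes adjoints: [A C^* = 0], so [C^*] takes its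
values in [N(A)], and [<C u, v> = <u, C^* v>] vanishes for [u] in
[N(A)^\perp]. *)
Lemma star_leP A B : star_le A B <->
  (forall x y, inner (A x) (B y - A y) = 0) /\
  (forall u, orthocompl (nullspace A) u -> B u = A u).
Proof.
split=> [[AA_AB AA_BA]|[ranAC eqAB]]; split.
- move=> x y; rewrite linearB /= !inner_adjoint.
  by rewrite -[adjoint A (B y)]/((adjoint A \o B) y) -AA_AB subrr.
- move=> u uA; apply/subr0_eq/inner_eq0; set v := B u - A u.
  have adjC y : inner (B y - A y) v = inner y (adjoint B v - adjoint A v).
    by rewrite linearBl /= !inner_adjoint -linearB.
  rewrite {1}/v adjC uA// /nullspace /=; apply/innerP => z.
  rewrite linear0r; apply: inner0C; rewrite inner_adjoint; apply: inner0C.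
  have AAz : A (adjoint A z) = B (adjoint A z) := congr1 (@^~ z) AA_BA.
  by rewrite -adjC -AAz subrr linear0l.
- apply/funext => y /=; apply/innerP => x; apply/subr0_eq.
  by rewrite -!inner_adjoint -opprB -linearB /= ranAC oppr0.
- by apply/funext => y /=; rewrite eqAB//; exact: adjoint_orthocompl_nullspace.
Qed.

Lemma mp_inverse_total T w : closed (range T) -> partial_dom (mp_inverse T) w.
Proof.
move=> clT; have [x [z [_ Tz ->]]] := mp_decomposition w clT.
by exists (T x); [exists x|exists z].
Qed.

(** The witnesses are the orthogonal projections onto [R(A)] and [N(A)^\perp].
That [A^* = Q B^*] is the adjoint form of [A = B Q]. *)
Lemma star_le_minus A B : closed (range A) -> star_le A B -> minus_le A B.
Proof.
move=> clA /star_leP[ranAC eqAB].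
have clN : closed (nullspace A) by apply/closed_kernel/continuous_bounded_op.
have sN : linear_subspace (nullspace A) := subspace_kernel A.
have sA := subspace_range A.
have sNC := subspace_orthocompl (nullspace A).
have [P PA] := closed_subspace_projection clA sA.
have clNC := @closed_orthocompl R H (nullspace A).
have [Q QA] := closed_subspace_projection clNC sNC.
exists P, Q; split.
- exact: projection_idem sA PA.
- exact: projection_idem sNC QA.
- apply/funext => x /=; apply/esym/(projection_id sA PA); first by exists x.
  by move=> _ [y _ <-]; rewrite inner0C// ranAC.
- apply/funext => y /=; apply: adjointE => x.
  rewrite -(projection_selfadjoint _ _ QA) -inner_adjoint.
  have [/eqAB -> /(orthocomplK clN sN) xQx] := QA x.
  by rewrite (_ : A x = A (Q x))//; apply/subr0_eq; rewrite -linearB.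
Qed.

(** Let [w = B x + z] be the decomposition that computes [B^\dagger w], let
[C = B - A], and split [x = (x - n) + n] with [n] the projection of [x] onto
[N(A)]; the operators [A] and [B] agree on [x - n], and [A n = 0]; so
[B x = A (x - n) + C n].  The vectors [x - n] and [n] are the values of
[A^\dagger] and [C^\dagger] at [w]. *)
Lemma star_le_mp A B : closed (range A) -> closed (range B) -> star_le A B ->
  partial_eq (mp_inverse (B \- A)) (partial_sub (mp_inverse B) (mp_inverse A)).
Proof.
move=> clA clB /star_leP[ranAC eqAB].
have clN : closed (nullspace A) by apply/closed_kernel/continuous_bounded_op.
have mpE w : exists q p r, [/\ mp_inverse B w = q + p, mp_inverse A w = q,
    orthocompl (nullspace (B \- A)) p,
    orthocompl (range (B \- A)) r & w = (B \- A) p + r].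
  have [x [z [Bx Bz wE]]] := mp_decomposition w clB.
  have [n An xnA] := closed_subspace_proj x clN (subspace_kernel A).
  have An0 : A n = 0 := An.
  have Axn : A (x - n) = A x by rewrite linearB /= An0 subr0.
  have Bxn : B (x - n) = A x by rewrite eqAB.
  have Cn : B n = (B \- A) x.
    by rewrite /= -Bxn linearB /= opprB addrC subrK.
  have ranAB u : exists v, A u = B v.
    have [m Am umA] := closed_subspace_proj u clN (subspace_kernel A).
    by exists (u - m); rewrite (eqAB _ umA) linearB /= [A m]Am subr0.
  have zA u : inner z (A u) = 0 by have [v ->] := ranAB u; exact: Bz.
  exists (x - n), n, (A x + z); split.
  - by rewrite subrK wE mp_inverseE.
  - rewrite wE (_ : B x = A (x - n) + (B x - A x)); last first.
      by rewrite Axn addrC subrK.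
    rewrite -addrA mp_inverseE// => _ [u _ <-].
    by rewrite linearDl /= zA addr0 inner0C// ranAC.
  (* The part of [k] orthogonal to [N(A)] is orthogonal to [n]; the other part
     [m] is in [N(A)] and, as [C k = 0], also in [N(B)], so that it is
     orthogonal to [x] and to [x - n]. *)
  - move=> k /= Ck.
    have [m Am kmA] := closed_subspace_proj k clN (subspace_kernel A).
    have Bm : B m = 0.
      have Am0 : A m = 0 := Am.
      have := eqAB _ kmA; rewrite !linearB /= Am0 subr0 => /eqP.
      by rewrite subr_eq addrC -subr_eq [B k - A k]Ck => /eqP.
    have km : inner (x - n) m = 0 by rewrite xnA.
    have nkm : inner n (k - m) = 0 by rewrite inner0C// kmA.
    rewrite -(subrK m k) linearDr /= nkm add0r.
    by rewrite -[n](subKr x) linearBl /= km subr0 Bx.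
  - move=> _ [u _ <-] /=; rewrite linearDl /= ranAC add0r linearB /= zA subr0.
    by apply: Bz; exists u.
  - by rewrite /= An0 subr0 Cn /= wE addrA subrK.
split=> [|w _].
  apply/seteqP; split=> w _ /=; first by split; exact: mp_inverse_total.
  have [q [p [r [_ _ _ Cr wE]]]] := mpE w.
  by rewrite wE; exists ((B \- A) p); [exists p|exists r].
have [q [p [r [Bw Aw Cp Cr wE]]]] := mpE w.
rewrite -[RHS]/(mp_inverse B w - mp_inverse A w) Bw Aw {1}wE mp_inverseE//.
by rewrite addrC addKr.
Qed.

(** In the minus order [A^*] vanishes where [B^*] does.  Applied to the
component of [A u] orthogonal to [R(B)], which [B^*] kills, this shows that the
component is orthogonal to [A u] and hence is 0. *)
Lemma minus_le_range A B : closed (range B) -> minus_le A B ->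
  range A `<=` range B.
Proof.
move=> clB [_ [Q [_ _ _ AQB]]] _ [u _ <-].
have [_ [x _ <-] z0] := closed_subspace_proj (A u) clB (subspace_range B).
exists x => //; apply/esym/subr0_eq/inner_eq0; set z := A u - B x in z0 *.
have Bz : adjoint B z = 0.
  by apply: adjointE => y; rewrite linear0r inner0C// z0.
have Az : adjoint A z = 0 by rewrite AQB /= Bz linear0.
by rewrite {1}/z linearBl /= inner_adjoint Az linear0r (inner0C (z0 _ _)) ?subrr.
Qed.

(** [A] and [B] are compared through the component [d] of [A u] orthogonal to
the range of [C = B - A], because [C^\dagger d = 0]. *)
Lemma minus_mp_star A B : closed (range A) -> closed (range B) ->
  minus_le A B ->
  partial_eq (mp_inverse (B \- A)) (partial_sub (mp_inverse B) (mp_inverse A)) ->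
  star_le A B.
Proof.
move=> clA clB AleB [domE mpE].
have ranAB := minus_le_range clB AleB.
have [P [_ [idP _ APB _]]] := AleB.
have PB y : P (B y) = A y by rewrite [in RHS]APB.
have PA y : P (A y) = A y.
  by rewrite -PB -[P (P _)]/((P \o P) _) idP.
have C_total w : partial_dom (mp_inverse (B \- A)) w.
  by rewrite domE; split; exact: mp_inverse_total.
have key u : exists x, [/\ orthocompl (nullspace A) x, A x = A u, B x = A u &
    orthocompl (range (B \- A)) (A u)].
  have [_ [v _ <-] [d dC]] := C_total (A u); set c := (B \- A) v => cdE0.
  have cdE : c + d = A u := cdE0.
  have Bd : range B d.
    have -> : d = (-1) *: c + A u by rewrite scaleN1r -cdE addKr.
    apply: (subspace_range B).2; last by apply: ranAB; exists u.
    have -> : c = (-1) *: A v + B v by rewrite scaleN1r addrC.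
    by apply: (subspace_range B).2; [apply: ranAB; exists v|exists v].
  have [s [r [sB rB dEB]]] := mp_decomposition d clB.
  have [x [z [xA zA dEA]]] := mp_decomposition d clA.
  (* [s], [x] and [0] are the values at [d] of [B^\dagger], [A^\dagger] and
     [C^\dagger]. *)
  have sx : s = x.
    apply/subr0_eq; have := mpE d (C_total d).
    rewrite -[RHS]/(mp_inverse B d - mp_inverse A d) {2}dEB {2}dEA.
    rewrite !mp_inverseE// => <-.
    have {1}-> : d = (B \- A) 0 + d by rewrite linear0 add0r.
    by rewrite mp_inverseE//; exact: (subspace_orthocompl _).1.
  have dBx : d = B x.
    apply/subr0_eq/inner_eq0; rewrite {1}dEB sx addrC addKr.
    by have [s0 _ <-] := Bd; rewrite linearB /= !rB ?subrr.
  have Axu : A x = A u.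
    by rewrite -(PA u) -cdE linearD /= linearB /= PB PA subrr add0r dBx PB.
  have zc : z = - c.
    by apply: (addrI (A x)); rewrite -dEA Axu -cdE addrAC subrr add0r.
  have c0 : c = 0.
    apply: inner_eq0; rewrite -{2}[c](addrK d) cdE linearB /=.
    rewrite (inner0C (dC _ _)) ?subr0; last by exists v.
    have -> : c = (-1) *: z by rewrite zc scaleN1r opprK.
    by rewrite innerZl zA ?mulr0//; exists u.
  exists x; split=> //; first by rewrite -dBx -cdE c0 add0r.
  by rewrite -cdE c0 add0r.
apply/star_leP; split=> [x y|u uA].
  by have [_ [_ _ _ uC]] := key x; apply: uC; exists y.
have [x [xA Axu Bxu _]] := key u.
suff <- : x = u by rewrite Bxu Axu.
apply/subr0_eq/inner_eq0; rewrite linearBl /= xA ?uA ?subrr//.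
all: by rewrite /nullspace /= linearB /= Axu subrr.
Qed.

End Orders.

Theorem theorem3p7 (R : realType) (H : hilbertType R) (A B : bounded_op H) :
  closed (range A) -> closed (range B) ->
  star_le A B <->
  minus_le A B /\
  partial_eq (mp_inverse (B \- A)) (partial_sub (mp_inverse B) (mp_inverse A)).
Proof.
move=> clA clB; split=> [AB|[AB mpE]]; last exact: minus_mp_star.
by split; [exact: star_le_minus|exact: star_le_mp].
Qed.
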